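(* Let $\delta>0$, $0<\varepsilon<1$, $0<\lambda<1$, $0<\alpha<1$, and let $(k_n)$ be a sequence of positive integers such that, as $n\to\infty$, $$k_n\uparrow\infty,\qquad \frac{k_n}{\log n}\uparrow\infty,\qquad \frac{\log k_n}{\log n}\downarrow 0 .$$ Define $$\lambda_n:=\lambda\,\frac{\log n}{n^{\alpha}},\qquad \tilde\lambda_n:=\lambda_n\left(1+2\sqrt{\frac{2}{\lambda}}\,\frac{1-\lambda_n}{n^{(1-\alpha)/2}}\right).$$ Then there exists $n_0$ such that for all $n\ge n_0$ there exists an event $\Omega_n\subset\Omega$ with $$\mathbb P[\Omega_n]\ \ge\ 1-4\left(\frac{1}{(\log n)^{1+\delta}}+\frac{e^{-k_n/16}}{1-e^{-1/16}}\right),$$ such that on $\Omega_n$: (a) for all integers $j$ with $k_n\le j\le n\tilde\lambda_n$, $$\sqrt{2\log n}\,(X_{j,n}-X_{1,n})\ \ge\ 2\log n\left(1-\sqrt{1-\frac{\log j}{\log n}}\right)(1-\varepsilon);$$ (b) for all integers $j$ with $n\tilde\lambda_n\le j\le n$, $$\sqrt{2\log n}\,(X_{j,n}-X_{1,n})\ >\ 2\log n\,\sqrt{1-\varepsilon}-G(\lambda_n)\sqrt{2\log n}.$$ In particular, if $j=j_n\le n$ is such that $\frac{\log j_n}{\log n}\uparrow 1$, then for all sufficiently large $n$, on $\Omega_n$, $$\sqrt{2\log n}\,(X_{j_n,n}-X_{1,n})\ >\ 2\log n\,\sqrt{1-\varepsilon}-G(\lambda_n)\sqrt{2\log n}.$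$
   Context: For each $n$, $(X_i)_{1\le i\le n}$ are i.i.d. standard Gaussian random variables on a probability space $(\Omega,\Sigma,\mathbb P)$, and $X_{1,n}\le X_{2,n}\le\cdots\le X_{n,n}$ denote their order statistics. $\Phi$ is the standard Gaussian distribution function, and $G:(0,1)\to\mathbb R$ is defined by $1-\Phi(G(u))=u$. The notation $\uparrow$, $\downarrow$ indicates the limit along the sequence (convergence to the indicated limit from below, resp. above). *)

(* Defs.v *)
From HB Require Import structures.
From mathcomp Require Import all_boot all_order all_algebra.
From mathcomp Require Import all_classical all_reals all_analysis.
From mathcomp Require Import measurable_realfun.

Set Implicit Arguments.
Unset Strict Implicit.
Unset Printing Implicit Defensive.

Import Order.TTheory GRing.Theory Num.Theory.
Import numFieldNormedType.Exports.

Local Open Scope classical_set_scope.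
Local Open Scope ring_scope.

Section Gaussian_tail.
Context {R : realType}.
Implicit Types x y u : R.

Definition Phi x : R := fine (normal_prob (0 : R) 1 `]-oo, x]).

(* Inverse of the tail [1 - Phi]. Only its values on ]0, 1[ are meaningful;
   there the defining equation has a solution, see [gauss_tail_invP]. *)
Definition gauss_tail_inv u : R := get [set x : R | 1 - Phi x = u].

Lemma PhiE x : (Phi x)%:E = normal_prob (0 : R) 1 `]-oo, x].
Proof. by rewrite /Phi fineK// fin_num_measure. Qed.

Lemma Phi_lip x y : x <= y -> Phi x <= Phi y <= Phi x + normal_peak 1 * (y - x).
Proof.
move=> xy; have -> : Phi y = Phi x + fine (normal_prob (0 : R) 1 `]x, y]).
  apply: EFin_inj; rewrite EFinD !PhiE fineK ?fin_num_measure//.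
  rewrite -measureU//; first last.
    rewrite -subset0 => z /= -[]; rewrite !in_itv/= => zx /andP[].
    by rewrite ltNge zx.
  by rewrite -itv_bndbnd_setU// bnd_simp.
rewrite lerDl fine_ge0//= lerD2l -lee_fin fineK ?fin_num_measure//.
rewrite /normal_prob.
apply: (@le_trans _ _
  (\int[lebesgue_measure]_(z in `]x, y]) (normal_peak (1 : R))%:E)%E).
  apply: ge0_le_integral => //.
  - by move=> z _; rewrite lee_fin normal_pdf_ge0.
  - apply/measurable_EFinP; apply: measurable_funTS.
    exact: measurable_normal_pdf.
  - by move=> z _; rewrite lee_fin normal_pdf_ub.
rewrite integral_cst//= lebesgue_measure_itv/= lte_fin.
have [_|] := ltP x y; first by rewrite -EFinD -EFinM.
by rewrite mule0 lee_fin mulr_ge0// ?normal_peak_ge0// subr_ge0.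
Qed.

Lemma continuous_Phi : continuous (Phi : R -> R).
Proof.
move=> x; apply/cvgrPdist_le => /= e e0.
have p0 : 0 < normal_peak (1 : R) by rewrite normal_peak_gt0.
near=> y.
have yx : `|x - y| <= e / normal_peak 1.
  near: y; apply: (@cvgr_dist_le _ _ _ _ _ id) => //.
  by rewrite divr_gt0.
rewrite ler_pdivlMr// mulrC in yx; apply: le_trans yx.
have [xy|/ltW yx] := leP x y.
  have /andP[h1 h2] := Phi_lip xy.
  by rewrite distrC ger0_norm ?subr_ge0// distrC ger0_norm ?subr_ge0// lerBlDl.
have /andP[h1 h2] := Phi_lip yx.
by rewrite ger0_norm ?subr_ge0// ger0_norm ?subr_ge0// lerBlDl.
Unshelve. all: by end_near. Qed.

Lemma Phi_cvgy : Phi x @[x --> +oo] --> (1 : R).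
Proof.
have mid : (idfun : measurableTypeR R -> R) \in mfun.
  by rewrite inE; exact: measurable_id.
pose X : {RV (normal_prob (0 : R) 1) >-> R} := mfun_Sub mid.
by have := @cvg_cdfy1 _ _ _ _ X => /fine_cvg.
Qed.

Lemma Phi_cvgNy : Phi x @[x --> -oo] --> (0 : R).
Proof.
have mid : (idfun : measurableTypeR R -> R) \in mfun.
  by rewrite inE; exact: measurable_id.
pose X : {RV (normal_prob (0 : R) 1) >-> R} := mfun_Sub mid.
by have := @cvg_cdfNy0 _ _ _ _ X => /fine_cvg.
Qed.

Lemma gauss_tail_invP u : 0 < u < 1 -> 1 - Phi (gauss_tail_inv u) = u.
Proof.
move=> /andP[u0 u1]; suff [x xu] : exists x, Phi x = 1 - u.
  rewrite /gauss_tail_inv; case: xgetP => [y _ //|/(_ x)]/=.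
  by rewrite xu subKr.
have [b [bu b0]] : exists b, 1 - u <= Phi b /\ 0 <= b.
  near (+oo : set_system R) => b; exists b; split; last first.
    by near: b; exact: nbhs_pinfty_ge.
  near: b; apply: (cvgr_ge _ Phi_cvgy).
  by rewrite gtrBl.
have [a [au a0]] : exists a, Phi a <= 1 - u /\ a <= 0.
  near (-oo : set_system R) => a; exists a; split; last first.
    by near: a; exact: nbhs_ninfty_le.
  near: a; apply: (cvgr_le _ Phi_cvgNy).
  by rewrite subr_gt0.
have [|||x _ xu] := @IVT _ Phi a b (1 - u).
- exact: le_trans a0 b0.
- exact/continuous_subspaceT/continuous_Phi.
- by rewrite ge_min au le_max bu orbT.
by exists x.
Unshelve. all: by end_near. Qed.

End Gaussian_tail.

Section families.
Context d (T : measurableType d) (R : realType) (P : probability T R).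

Definition mutually_independent (I : finType) (X : I -> {RV P >-> R}) :=
  forall (J : {set I}) (A : I -> set R),
    (forall i, i \in J -> measurable (A i)) ->
    P (\bigcap_(i in [set` J]) (X i @^-1` A i)) =
      (\prod_(i in J) P (X i @^-1` A i))%E.

Definition standard_gaussian (X : {RV P >-> R}) :=
  forall A : set R, measurable A -> distribution P X A = normal_prob 0 1 A.

Definition iid_standard_gaussian (I : finType) (X : I -> {RV P >-> R}) :=
  mutually_independent X /\ forall i, standard_gaussian (X i).

End families.

Section sequences.
Context {R : realType}.

(* [order_stat x j] is the [j]-th smallest of the [n] values of [x], counted
   from [1]; it is meaningful for [1 <= j <= n] only. *)
Definition order_stat n (x : 'I_n -> R) (j : nat) : R :=
  nth 0 (sort <=%R [seq x i | i : 'I_n]) j.-1.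

Definition lambda_n (lambda alpha : R) (n : nat) : R :=
  lambda * ln n%:R / n%:R `^ alpha.

Definition tlambda_n (lambda alpha : R) (n : nat) : R :=
  lambda_n lambda alpha n *
  (1 + 2 * Num.sqrt (2 / lambda) *
       ((1 - lambda_n lambda alpha n) / n%:R `^ ((1 - alpha) / 2))).

End sequences.

(* Main.v *)
Require Import Defs.
From HB Require Import structures.
From mathcomp Require Import all_boot all_order all_algebra.
From mathcomp Require Import all_classical all_reals all_analysis.
From mathcomp Require Import measurable_realfun ring lra.
Import Order.TTheory GRing.Theory Num.Theory.
Import numFieldNormedType.Exports.
Local Open Scope classical_set_scope.
Local Open Scope ring_scope.

(** Write [Q = 1 - Phi] and [L = ln n], and let [G] be the inverse of [Q]. The
    sample is controlled at the levels [t1 = G(L^eta / n)], with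
    [eta = eps / 3], and [t2(j) = G(j / (n e^2))]. The event keeps the samples
    whose minimum lies below [- t1] and whose [j]-th smallest value is at least
    [- t2(j)] for every [j] between [k] and [n]. On it, [X_j - X_1] exceeds
    [t1 - t2(j)], and both conclusions become statements about Gaussian
    quantiles.

    Probability of the event. All [n] values exceed [- t1] with probability
    [(1 - Q(t1))^n <= exp(- L^eta)], which is below [L^-(1 + delta)] for large
    [n]. If the [j]-th smallest value is less than [- t2(j)], then some [j]
    indices have all their values below it; the union bound over these index
    sets costs ['C(n, j) (j / (n e^2))^j <= e^-j], because [j^j / j! <= e^j].
    Summing over [j >= k] gives a geometric tail ([prob_good_event],
    [bin_expR_le], [sum_expR_tail]).

    Size of [t1 - t2]. Two comparisons of [Q(s)] with [Q(t)], [0 < s <= t],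
    carry the analysis. Integrating the density after an affine change of
    variable gives
      [(s / t) e^-(t^2 - s^2)/2 Q(s) <= Q(t) <= e^-(t^2 - s^2)/2 Q(s)]
    ([gauss_tail_decay_lb], [gauss_tail_decay]). The left inequality turns the
    ratio [Q(t2) / Q(t1) = j^(1 + o(1))] into
      [(1 - o(1)) ln j <= (t1 - t2) (t1 + t2) / 2 * (1 + o(1))],
    while the right one bounds [t1] by [sqrt (2 L)] and [t2] by
    [sqrt (2 L) sqrt (1 - ln j / L) + 2]. Since
    [ln j = L (1 - r) (1 + r)] with [r = sqrt (1 - ln j / L)], the factor
    [1 + r] cancels and (a) follows ([gauss_quantile_gap]). The difference
    [t1 - t2] is read off the ratio of the two tails, not off separate
    estimates of [t1] and [t2]: when [ln j] is only of order [ln L], the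
    spacing is of the same order as the corrections by which each level
    departs from its leading term.

    For (b) the slack between [sqrt (2 L)] and [sqrt (2 L) sqrt (1 - eps)] is
    unbounded, so that crude estimates suffice: [t1] exceeds the latter by 2
    ([gauss_quantile_lower]), and [t2(j)] exceeds [G(lambda_n)] by at most 2,
    since dividing the tail by [e^2] moves a nonnegative quantile by at most 2
    ([gauss_quantile_shift]). *)

Set Implicit Arguments.
Unset Strict Implicit.
Unset Printing Implicit Defensive.

(** * Comparison of Gaussian tails *)

Section gauss_tail.
Context {R : realType}.
Implicit Types a s t x : R.
Local Notation mu := lebesgue_measure.
Local Notation phi := (normal_pdf (0 : R) 1).

Definition gauss_tail x : R := 1 - Phi x.

Lemma gauss_tailE x :
  (gauss_tail x)%:E = (\int[mu]_(z in `[x, +oo[) (phi z)%:E)%E.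
Proof.
rewrite -integral_itv_obnd_cbnd; last first.
  by apply/measurable_EFinP/measurable_funTS; exact: measurable_normal_pdf.
have -> : `]x, +oo[%classic = ~` (`]-oo, x]%classic : set R).
  by rewrite setCitvl.
rewrite -/(normal_prob _ _ _) EFinB PhiE.
exact/esym/probability_setC.
Qed.

(** Substitution of the increasing affine map that sends [s] to [t] with slope
    [a]: both comparisons below put two tails over the same half-line this
    way, and then compare integrands. *)
Lemma gauss_tail_subst a s t : 0 < a ->
  (gauss_tail t)%:E =
  (\int[mu]_(x in `[s, +oo[) (phi ((x - s) * a + t) * a)%:E)%E.
Proof.
move=> a0; pose F x : R := (x - s) * a + t.
have dF x : is_derive x (1 : R) F a.
  apply: is_derive_eq.
  by rewrite !scaler0 addr0 add0r oppr0 addr0 /GRing.scale/=; ring.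
have F' : F^`()%classic = cst a.
  by apply/funext => x; rewrite derive1E; apply: derive_val.
have Fs : F s = t by rewrite /F subrr mul0r add0r.
have cF : continuous F.
  by move=> x; apply/differentiable_continuous/derivable1_diffP; case: (dF x).
rewrite gauss_tailE -{1}Fs increasing_ge0_integration_by_substitutiony//.
- by apply: eq_integral => x _; rewrite F'.
- by move=> x y _ _ xy; rewrite /F ltrD2r ltr_pM2r// ltrD2r.
- by rewrite F' => x _; exact: cvg_cst.
- by rewrite F'; exact: is_cvg_cst.
- by rewrite F'; exact: is_cvg_cst.
- by split=> [x _|]; [case: (dF x)|exact/cvg_at_right_filter/cF].
- apply: (@cvg_comp _ _ _ (fun x => (x - s) * a) (fun x => x + t)); last first.
    exact: cvg_addrr.
  by apply: gt0_cvgMly => //; exact: cvg_addrr.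
- exact/continuous_subspaceT/continuous_normal_pdf/oner_neq0.
- by move=> x _; exact: normal_pdf_ge0.
Qed.

Lemma normal_pdf01 x : phi x = normal_peak 1 * expR (- (x ^+ 2 / 2)).
Proof. by rewrite normal_pdfE ?oner_neq0// /normal_fun subr0 expr1n mulNr. Qed.

Lemma measurable_normal_pdf_affine a s t :
  measurable_fun `[s, +oo[ (fun x => (phi ((x - s) * a + t) * a)%:E).
Proof.
apply/measurable_EFinP/measurable_funTS/measurable_funM => //.
apply: measurableT_comp; first exact: measurable_normal_pdf.
apply: measurable_funD => //; apply: measurable_funM => //.
exact: measurable_funB.
Qed.

(** Translation by [t - s >= 0] adds at least [t^2 - s^2] to the square of a
    point [x >= s]. *)
Lemma gauss_tail_decay s t : s <= t ->
  gauss_tail t <= expR (- ((t ^+ 2 - s ^+ 2) / 2)) * gauss_tail s.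
Proof.
move=> st; rewrite -lee_fin EFinM (@gauss_tail_subst 1 s t)// gauss_tailE.
rewrite -ge0_integralZl//; last 2 first.
- by apply/measurable_EFinP/measurable_funTS; exact: measurable_normal_pdf.
- by move=> x _; rewrite lee_fin normal_pdf_ge0.
apply: ge0_le_integral => //.
- by move=> x _; rewrite lee_fin mulr_ge0// normal_pdf_ge0.
- exact: measurable_normal_pdf_affine.
- apply/measurable_EFinP/measurable_funTS/measurable_funM => //.
  exact: measurable_normal_pdf.
- move=> x /=; rewrite in_itv/= andbT => sx; rewrite -EFinM lee_fin !mulr1.
  rewrite !normal_pdf01 mulrCA ler_wpM2l ?normal_peak_ge0// -expRD ler_expR.
  nra.
Qed.

(** Substitution with slope [s / t] makes the cross terms agree: the image [y]
    of [x >= s] satisfies [y^2 = t^2 + 2 s (x - s) + (s / t)^2 (x - s)^2],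
    which is at most [t^2 - s^2 + x^2]. In other words [t e^(t^2/2) Q(t)] is
    nondecreasing, which replaces an upper bound on the hazard rate. *)
Lemma gauss_tail_decay_lb s t : 0 < s <= t ->
  s / t * expR (- ((t ^+ 2 - s ^+ 2) / 2)) * gauss_tail s <= gauss_tail t.
Proof.
move=> /andP[s0 st]; have t0 := lt_le_trans s0 st.
have a0 : 0 < s / t by rewrite divr_gt0.
rewrite -lee_fin EFinM (@gauss_tail_subst (s / t) s t)// gauss_tailE.
rewrite -ge0_integralZl//; last 3 first.
- by apply/measurable_EFinP/measurable_funTS; exact: measurable_normal_pdf.
- by move=> x _; rewrite lee_fin normal_pdf_ge0.
- by rewrite lee_fin mulr_ge0 ?expR_ge0// ltW.
apply: ge0_le_integral => //.
- move=> x _; rewrite -EFinM lee_fin mulr_ge0 ?normal_pdf_ge0//.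
  by rewrite mulr_ge0 ?expR_ge0// ltW.
- apply/measurable_EFinP/measurable_funTS/measurable_funM => //.
  exact: measurable_normal_pdf.
- exact: measurable_normal_pdf_affine.
- move=> x /=; rewrite in_itv/= andbT => sx; rewrite -EFinM lee_fin.
  rewrite !normal_pdf01 [leRHS]mulrC -[leLHS]mulrA ler_pM2l//.
  rewrite mulrCA ler_wpM2l ?normal_peak_ge0// -expRD ler_expR.
  have -> : ((x - s) * (s / t) + t) ^+ 2 =
      (s / t) ^+ 2 * (x - s) ^+ 2 + 2 * s * (x - s) + t ^+ 2.
    by field; rewrite gt_eqF.
  have : (s / t) ^+ 2 * (x - s) ^+ 2 <= (x - s) ^+ 2.
    rewrite ler_piMl ?sqr_ge0// expr_le1 ?(ltW a0)//.
    by rewrite ler_pdivrMr ?mul1r.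
  nra.
Qed.

Lemma gauss_tail_le s t : s <= t -> gauss_tail t <= gauss_tail s.
Proof. by move=> /Phi_lip/andP[st _]; rewrite /gauss_tail lerB. Qed.

Lemma gauss_tail_lt s t : gauss_tail t < gauss_tail s -> s < t.
Proof. by rewrite !ltNge; apply: contra => /gauss_tail_le. Qed.

Lemma normal_prob_lt_opp x :
  normal_prob 0 1 `]-oo, - x[ = (gauss_tail x)%:E.
Proof.
rewrite gauss_tailE /normal_prob integral_itv_bndo_bndc; last first.
  by apply/measurable_EFinP/measurable_funTS; exact: measurable_normal_pdf.
rewrite ge0_integration_by_substitutionNy.
- by apply: eq_integral => y _; rewrite /= !normal_pdf01 sqrrN.
- exact/continuous_subspaceT/continuous_normal_pdf/oner_neq0.
- by move=> y _; exact: normal_pdf_ge0.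
Qed.

Lemma gauss_tail_ge0 x : 0 <= gauss_tail x.
Proof. by rewrite -lee_fin -normal_prob_lt_opp. Qed.

Lemma gauss_tail0 : gauss_tail 0 = 2^-1.
Proof.
have : gauss_tail 0 = Phi (0 : R).
  apply: EFin_inj; rewrite PhiE -normal_prob_lt_opp oppr0 /normal_prob.
  rewrite integral_itv_bndo_bndc//.
  by apply/measurable_EFinP/measurable_funTS; exact: measurable_normal_pdf.
rewrite /gauss_tail; lra.
Qed.

Lemma gauss_tail_expR_ub t : 0 <= t -> gauss_tail t <= expR (- (t ^+ 2 / 2)).
Proof.
move=> /gauss_tail_decay; rewrite gauss_tail0 expr0n subr0 => /le_trans; apply.
by rewrite ler_piMr ?expR_ge0//; lra.
Qed.

End gauss_tail.

(** * Order statistics *)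

Section order_statistics.
Context {R : realType} (n : nat) (x : 'I_n -> R).
Implicit Types (j : nat) (c : R).

Let s := sort <=%R [seq x i | i : 'I_n].

Let size_s : size s = n.
Proof. by rewrite size_sort size_map size_enum_ord. Qed.

Let sorted_s : sorted <=%R s.
Proof. by apply: sort_sorted; exact: le_total. Qed.

Lemma order_stat1_le i : order_stat x 1 <= x i.
Proof.
have xis : x i \in s by rewrite mem_sort map_f// mem_enum.
rewrite -(nth_index 0 xis).
apply: (sorted_leq_nth le_trans lexx 0 sorted_s) => //.
  by rewrite inE size_s; case: (n) i {xis} => // -[].
by rewrite inE index_mem.
Qed.

(** The first [j] entries of the sorted sample are at most its [j]-th entry. *)
Lemma order_stat_lt j c : (0 < j <= n)%N -> order_stat x j < c ->
  (j <= #|[set i | (x i < c)%R]%SET|)%N.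
Proof.
move=> /andP[j0 jn] xjc.
have -> : #|[set i | (x i < c)%R]%SET| = count (fun y => y < c) s.
  rewrite count_sort count_map cardE /enum_mem size_filter.
  by rewrite count_filter; apply: eq_count => i; rewrite /= !inE andbT.
rewrite -(cat_take_drop j s) count_cat -[leqLHS]addn0 leq_add//.
have sz : size (take j s) = j by rewrite size_take size_s; case: ltngtP jn.
suff : all (fun y => y < c) (take j s) by rewrite all_count sz => /eqP ->.
apply/(all_nthP 0) => i; rewrite sz => ij.
rewrite nth_take//; apply: le_lt_trans xjc.
apply: (sorted_leq_nth le_trans lexx 0 sorted_s).
- by rewrite inE size_s (leq_trans ij).
- by rewrite inE size_s prednK.
- by rewrite -ltnS prednK.
Qed.

End order_statistics.

(** * Binomial and geometric bounds *)

Section binomial_bounds.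
Context {R : realType}.

Lemma ffact_le_exp n j : (n ^_ j <= n ^ j)%N.
Proof.
by elim: j => // j IH; rewrite ffactnSr expnSr leq_mul// leq_subr.
Qed.

Lemma exprn_fact_le_expR j : (j%:R : R) ^+ j / j`!%:R <= expR j%:R.
Proof.
case: j => [|j]; first by rewrite expr0 fact0 divr1 expR0.
by apply: le_trans (expR_ge1Dxn j _) => //; rewrite lerDr.
Qed.

(** ['C(n, j) <= n^j / j!], and [j^j / j! <= e^j] leaves one factor [e^-j] out
    of the [e^-(2 j)]. *)
Lemma bin_expR_le n j : (0 < n)%N ->
  'C(n, j)%:R * (j%:R / (n%:R * expR 2)) ^+ j <= expR (- j%:R) :> R.
Proof.
move=> n0; have n0' : 0 < n%:R :> R by rewrite ltr0n.
have f0 : 0 < j`!%:R :> R by rewrite ltr0n fact_gt0.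
have binj : 'C(n, j)%:R <= n%:R ^+ j / j`!%:R :> R.
  by rewrite ler_pdivlMr// -natrM bin_ffact -natrX ler_nat ffact_le_exp.
apply: (@le_trans _ _ (n%:R ^+ j / j`!%:R * (j%:R / (n%:R * expR 2)) ^+ j)).
  by rewrite ler_wpM2r// exprn_ge0// divr_ge0// mulr_ge0// expR_ge0.
have -> : n%:R ^+ j / j`!%:R * (j%:R / (n%:R * expR 2)) ^+ j =
    (j%:R ^+ j / j`!%:R) * expR (- (2 * j%:R)) :> R.
  rewrite expRN mulrC expRM_natr expr_div_n exprMn.
  by field; rewrite !gt_eqF//= ?exprn_gt0 ?expR_gt0.
apply: (@le_trans _ _ (expR j%:R * expR (- (2 * j%:R)))).
  by rewrite ler_wpM2r ?expR_ge0// exprn_fact_le_expR.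
by rewrite -expRD ler_expR; lra.
Qed.

(** Telescoping gives the finite geometric sum without a limit. *)
Lemma sum_expR_tail (b : R) k n : 0 < b ->
  \sum_(k <= j < n) expR (- (j%:R * b)) <=
    expR (- (k%:R * b)) / (1 - expR (- b)).
Proof.
move=> b0; have q1 : expR (- b) < 1 by rewrite expR_lt1 oppr_lt0.
have q0 : 0 < 1 - expR (- b) by rewrite subr_gt0.
rewrite ler_pdivlMr//; have [nk|/ltnW kn] := leqP n k.
  by rewrite big_geq// mul0r expR_ge0.
have := @telescope_sumr R k n (fun j => - expR (- (j%:R * b))) kn.
rewrite mulr_suml => E.
rewrite (eq_bigr (fun j => - expR (- (j.+1%:R * b)) - - expR (- (j%:R * b)))).
  by rewrite E; have := expR_ge0 (- (n%:R * b)); lra.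
move=> j _; rewrite -[j.+1]addn1 natrD mulrDl mul1r opprD expRD; ring.
Qed.

End binomial_bounds.

(** * A high-probability event for the order statistics *)

Section good_event.
Context d (T : measurableType d) (R : realType) (P : probability T R).

Lemma measure_bigsetU_le (I : Type) (r : seq I) (p : pred I) (F : I -> set T) :
  (forall i, p i -> measurable (F i)) ->
  (P (\big[setU/set0]_(i <- r | p i) F i) <= \sum_(i <- r | p i) P (F i))%E.
Proof.
move=> mF.
suff [//] : measurable (\big[setU/set0]_(i <- r | p i) F i) /\
  (P (\big[setU/set0]_(i <- r | p i) F i) <= \sum_(i <- r | p i) P (F i))%E.
elim/big_ind2 : _ => [|A a B b [mA Aa] [mB Bb]|i pi].
- by rewrite measure0.
- split; first exact: measurableU.
  by rewrite (le_trans (measureU2 _ _ _))// leeD.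
- by split => //; exact: mF.
Qed.

Variables (n : nat) (X : 'I_n -> {RV P >-> R}).
Hypothesis iidX : iid_standard_gaussian X.

Lemma prob_bigcap_preimage (J : {set 'I_n}) (A : set R) (q : R) :
  measurable A -> normal_prob 0 1 A = q%:E ->
  P (\bigcap_(i in [set` J]) (X i @^-1` A)) = (q ^+ #|J|)%:E.
Proof.
case: iidX => indep gaussX mA Aq; rewrite (indep J (fun=> A))//.
rewrite -prodr_const -prodEFin; apply: eq_bigr => i _.
by rewrite -Aq -(gaussX i A mA).
Qed.

Definition all_above (t : R) : set T :=
  \bigcap_(i in [set` [set: 'I_n]%SET]) (X i @^-1` `[- t, +oo[).

(** Stated through index sets rather than through order statistics, so that
    independence applies to each term. *)
Definition many_below (s : R) (j : nat) : set T :=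
  \big[setU/set0]_(S : {set 'I_n} | #|S| == j)
    \bigcap_(i in [set` S]) (X i @^-1` `]-oo, - s[).

Lemma measurable_bigcap_preimage (J : {set 'I_n}) (A : set R) :
  measurable A -> measurable (\bigcap_(i in [set` J]) (X i @^-1` A)).
Proof.
move=> mA; apply: fin_bigcap_measurable => // i _.
by rewrite -[_ @^-1` _]setTI; exact: measurable_funP.
Qed.

Lemma measurable_many_below s j : measurable (many_below s j).
Proof.
by apply: bigsetU_measurable => S _; exact: measurable_bigcap_preimage.
Qed.

(** [1 - q <= e^-q] for each of the [n] independent factors. *)
Lemma prob_all_above t :
  (P (all_above t) <= (expR (- (n%:R * gauss_tail t)))%:E)%E.
Proof.
rewrite (@prob_bigcap_preimage _ _ (1 - gauss_tail t))//; last first.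
  rewrite EFinB -normal_prob_lt_opp -setCitvl; exact: probability_setC.
rewrite cardsT card_ord lee_fin.
have -> : - (n%:R * gauss_tail t) = n%:R * - gauss_tail t by rewrite mulrN.
rewrite expRM_natl lerXn2r ?nnegrE ?expR_ge0//; last exact: expR_ge1Dx.
rewrite subr_ge0 -lee_fin -normal_prob_lt_opp; exact: probability_le1.
Qed.

Lemma prob_many_below s j :
  (P (many_below s j) <= ('C(n, j)%:R * gauss_tail s ^+ j)%:E)%E.
Proof.
apply: (le_trans (measure_bigsetU_le _ _)).
  by move=> S _; exact: measurable_bigcap_preimage.
rewrite (eq_bigr (fun=> (gauss_tail s ^+ j)%:E)).
  rewrite sumEFin lee_fin sumr_const mulr_natl.
  by rewrite -[in leRHS](card_ord n) -card_draws cardsE.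
move=> S /eqP <-; apply: prob_bigcap_preimage => //; exact: normal_prob_lt_opp.
Qed.

Definition good_event (t : R) (s : nat -> R) (k : nat) : set T :=
  ~` (all_above t `|` \big[setU/set0]_(k <= j < n.+1) many_below (s j) j).

Lemma measurable_good_event t s k : measurable (good_event t s k).
Proof.
apply: measurableC; apply: measurableU; first exact: measurable_bigcap_preimage.
by apply: bigsetU_measurable => j _; exact: measurable_many_below.
Qed.

Lemma prob_good_event t s k :
  (P (good_event t s k) >=
   (1 - (expR (- (n%:R * gauss_tail t)) +
         \sum_(k <= j < n.+1) 'C(n, j)%:R * gauss_tail (s j) ^+ j))%:E)%E.
Proof.
have mA : measurable (all_above t) by exact: measurable_bigcap_preimage.
have mB : measurable (\big[setU/set0]_(k <= j < n.+1) many_below (s j) j).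
  by apply: bigsetU_measurable => j _; exact: measurable_many_below.
rewrite probability_setC; last exact: measurableU.
rewrite EFinB leeB// EFinD (le_trans (measureU2 _ mA mB))//.
rewrite leeD ?prob_all_above//.
apply: le_trans (measure_bigsetU_le _ _) _.
  by move=> j _; exact: measurable_many_below.
by rewrite -sumEFin; apply: lee_sum => j _; exact: prob_many_below.
Qed.

Lemma good_event_min t s k w : good_event t s k w ->
  order_stat (fun i => X i w) 1 < - t.
Proof.
move=> /not_orP[/existsNP[i /not_implyP[_ /negP Xit]] _].
apply: le_lt_trans (order_stat1_le _ i) _.
by move: Xit; rewrite in_itv/= andbT -ltNge.
Qed.

(** If the [j]-th smallest value were below [- s j], then [order_stat_lt] would
    give [j] indices with values below [- s j]. *)
Lemma good_event_ge t s k w : good_event t s k w ->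
  forall j, (0 < j)%N -> (k <= j <= n)%N ->
  - s j <= order_stat (fun i => X i w) j.
Proof.
move=> /not_orP[_ nB] j j0 /andP[kj jn]; rewrite leNgt; apply/negP => Xj.
have := order_stat_lt _ Xj; rewrite j0 jn => /(_ isT) card_below.
apply: nB; rewrite -bigcup_seq; exists j => /=.
  by rewrite mem_index_iota kj ltnS.
(* at least j indices are below the level; many_below needs exactly j *)
have /card_geqP[r [ru rj rsub]] := card_below.
rewrite /many_below (bigD1 [set i in r]%SET) /=; last first.
  by rewrite cardsE (card_uniqP ru) rj.
left => i /=; rewrite inE => /rsub.
by rewrite inE in_itv.
Qed.

End good_event.

(** * Gaussian quantiles *)

Section quantiles.
Context {R : realType}.
Implicit Types s t c l m L eta eps : R.

Lemma ler_of_sqr (x y : R) : 0 <= y -> x ^+ 2 <= y ^+ 2 -> x <= y.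
Proof. by move=> y0 xy; rewrite leNgt; apply/negP => yx; nra. Qed.

(** Follows from [gauss_tail_decay_lb], the factor [t / s] being absorbed by
    [t / s <= e^((t - s) / s)]; the difference [t - s] then factors out of the
    exponent. *)
Lemma gauss_tail_ratio s t : 0 < s <= t ->
  gauss_tail s <= expR ((t - s) * (s^-1 + (t + s) / 2)) * gauss_tail t.
Proof.
move=> /andP[s0 st]; have t0 := lt_le_trans s0 st.
have /(@gauss_tail_decay_lb R) Qst : 0 < s <= t by rewrite s0.
set D := (t ^+ 2 - s ^+ 2) / 2 in Qst.
apply: (@le_trans _ _ (t / s * expR D * gauss_tail t)).
  have tsD : 0 <= t / s * expR D by rewrite mulr_ge0 ?expR_ge0// divr_ge0// ltW.
  apply: le_trans (ler_wpM2l tsD Qst).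
  rewrite expRN le_eqVlt; apply/orP; left; apply/eqP.
  by field; rewrite !gt_eqF// expR_gt0.
rewrite ler_wpM2r ?gauss_tail_ge0//.
have -> : (t - s) * (s^-1 + (t + s) / 2) = (t - s) / s + D.
  by rewrite /D; field; rewrite gt_eqF.
rewrite expRD ler_wpM2r ?expR_ge0//.
apply: le_trans (expR_ge1Dx _).
by rewrite mulrBl divff ?gt_eqF//; lra.
Qed.

(** The real-variable core of part (a), with [L = ln n], [l = ln j] and
    [m = eta * ln (ln n)]. The quantity [2 + m] is the loss in
    [ln (Q(t2) / Q(t1)) = l - 2 - m]; the constant [c] keeps [t2] away from 0,
    so that the error [1 / t2] is negligible with respect to [t1 + t2]. *)
Lemma gauss_quantile_gap c eta L l m t1 t2 :
  0 < eta -> 0 < c -> 0 <= m -> 0 < l <= L ->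
  2 + m <= 2 * eta * l ->
  1 + c^-1 <= eta * Num.sqrt (2 * L) / 2 ->
  c <= t2 <= t1 ->
  gauss_tail t1 = expR (m - L) -> gauss_tail t2 = expR (l - 2 - L) ->
  2 * L * (1 - Num.sqrt (1 - l / L)) * (1 - 3 * eta) <=
  Num.sqrt (2 * L) * (t1 - t2).
Proof.
move=> eta0 c0 m0 /andP[l0 lL] hml hc /andP[ct2 t21] Q1 Q2.
have L0 : 0 < L by lra.
have t20 : 0 < t2 by lra.
have t10 : 0 < t1 by lra.
set S := Num.sqrt (2 * L) in hc *; set r := Num.sqrt (1 - l / L).
have S2 : S ^+ 2 = 2 * L by rewrite sqr_sqrtr//; lra.
have S0 : 0 < S by rewrite sqrtr_gt0; lra.
have r0 : 0 <= r by rewrite sqrtr_ge0.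
have lLr : l = L * (1 - r) * (1 + r).
  have r2 : r ^+ 2 = 1 - l / L.
    by rewrite sqr_sqrtr// subr_ge0 ler_pdivrMr// mul1r.
  have -> : L * (1 - r) * (1 + r) = L * (1 - r ^+ 2) by ring.
  by rewrite r2; field; rewrite gt_eqF.
have r1 : r <= 1.
  by rewrite -[leRHS]sqrtr1 ler_sqrt// gerBl divr_ge0// ltW.
have ub t x : 0 < t -> gauss_tail t = expR x -> t ^+ 2 <= - 2 * x.
  move=> t0 Qt; have := gauss_tail_expR_ub (ltW t0).
  by rewrite Qt ler_expR; lra.
have t1S : t1 <= S.
  by apply: ler_of_sqr; rewrite ?S2; [exact: ltW|have := ub _ _ t10 Q1; lra].
have t2S : t2 <= S * r + 2.
  have Sr0 : 0 <= S * r by rewrite mulr_ge0// ltW.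
  apply: ler_of_sqr; first by lra.
  apply: le_trans (ub _ _ t20 Q2) _.
  have -> : (S * r + 2) ^+ 2 = S ^+ 2 * r ^+ 2 + 4 * (S * r) + 4 by ring.
  by rewrite S2; nra.
have gap : (1 - 2 * eta) * l <= (t1 - t2) * (t2^-1 + (t1 + t2) / 2).
  have := @gauss_tail_ratio t2 t1.
  rewrite t20 t21 Q1 Q2 -expRD ler_expR => /(_ isT).
  lra.
have den : t2^-1 + (t1 + t2) / 2 <= (1 + eta) * (S * (1 + r) / 2).
  have tc : t2^-1 <= c^-1 by rewrite lef_pV2 ?posrE.
  have : 0 <= eta * S * r by rewrite !mulr_ge0 ?(ltW eta0) ?(ltW S0).
  lra.
have gap' : (1 - 2 * eta) * l <= (t1 - t2) * ((1 + eta) * (S * (1 + r) / 2)).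
  by apply: le_trans gap _; rewrite ler_wpM2l// subr_ge0.
(* divide by (1 + r) / 2 *)
have {gap gap'} :
    (1 - 2 * eta) * (2 * L * (1 - r)) <= (1 + eta) * (S * (t1 - t2)).
  have r10 : 0 < (1 + r) / 2 by lra.
  by rewrite -(ler_pM2r r10); move: gap'; rewrite {1}lLr; lra.
have : 0 <= 2 * L * (1 - r) by rewrite mulr_ge0//; lra.
set a := 2 * L * (1 - r); set b := S * (t1 - t2) => a0 ab.
have e10 : 0 < 1 + eta by lra.
(* (1 - 3 eta) (1 + eta) <= 1 - 2 eta *)
rewrite -(ler_pM2l e10); nra.
Qed.

(** At [r = sqrt (2 L) sqrt (1 - eps) + 2] the exponent [r^2 / 2] falls short
    of [L] by about [eps * L], which dominates [m], the cross term in [r^2] and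
    the polynomial factor lost in [gauss_tail_decay_lb]; hence
    [Q(t) < Q(r)]. The comparison starts from a point [c > 0] at which the
    tail is known. *)
Lemma gauss_quantile_lower eps c m L t :
  0 < eps < 1 -> 0 < c -> gauss_tail c = 4^-1 -> 1 <= L -> m <= ln L ->
  10 + 24 / c < eps * Num.sqrt (2 * L) ->
  gauss_tail t = expR (m - L) ->
  Num.sqrt (2 * L) * Num.sqrt (1 - eps) + 2 < t.
Proof.
move=> /andP[e0 e1] c0 Qc L1 mL hS Qt.
set S := Num.sqrt (2 * L) in hS *; set q := Num.sqrt (1 - eps).
have S2 : S ^+ 2 = 2 * L by rewrite sqr_sqrtr//; lra.
have S0 : 0 < S by rewrite sqrtr_gt0; lra.
have S1 : 1 <= S.
  by apply: ler_of_sqr; rewrite ?expr1n ?S2; lra.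
have q2 : q ^+ 2 = 1 - eps by rewrite sqr_sqrtr//; lra.
have q0 : 0 <= q by rewrite sqrtr_ge0.
have q1 : q <= 1 by rewrite -[leRHS]sqrtr1 ler_sqrt//; lra.
have Sq : S * q <= S by rewrite ler_piMr// ltW.
have lnLS : ln L <= 2 * S.
  have -> : ln L = 2 * ln (Num.sqrt L).
    by rewrite -{1}(@sqr_sqrtr _ L) ?lnXn ?mulr_natl ?sqrtr_gt0//; lra.
  rewrite ler_pM2l// (le_trans (ltW (ln_sublinear _)))//.
    by rewrite sqrtr_gt0; lra.
  by rewrite ler_sqrt//; lra.
set r := S * q + 2; have r2 : 2 <= r by rewrite lerDr mulr_ge0// ltW.
have r0 : 0 < r by lra.
rewrite ltNge; apply/negP => /gauss_tail_le; rewrite Qt.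
apply/negP; rewrite -ltNge.
have cr : c <= r.
  apply: le_trans r2; apply/ltW/gauss_tail_lt; rewrite Qc.
  apply: le_lt_trans (gauss_tail_expR_ub _) _ => //.
  rewrite expRN ltf_pV2 ?posrE ?expR_gt0//.
  have -> : 2 ^+ 2 / 2 = 1 + 1 :> R by lra.
  by rewrite expRD; have := expR_gt1Dx (oner_neq0 R); nra.
have /(@gauss_tail_decay_lb R) : 0 < c <= r by rewrite c0.
apply: lt_le_trans; rewrite Qc.
have -> : c / r * expR (- ((r ^+ 2 - c ^+ 2) / 2)) / 4 =
  expR (- (r ^+ 2 / 2)) * (c / (4 * r) * expR (c ^+ 2 / 2)).
  have -> : - ((r ^+ 2 - c ^+ 2) / 2) = - (r ^+ 2 / 2) + c ^+ 2 / 2 by lra.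
  by rewrite expRD; field; rewrite gt_eqF.
(* E is the surplus exponent; 1 + E <= exp E is enough *)
set E := L - m - r ^+ 2 / 2.
have -> : m - L = - (r ^+ 2 / 2) - E by rewrite /E; ring.
rewrite expRD ltr_pM2l ?expR_gt0//.
apply: (@lt_le_trans _ _ (c / (4 * r))); last first.
  rewrite ler_peMr//; first by rewrite divr_ge0// ltW// mulr_gt0.
  by rewrite -expR0 ler_expR divr_ge0// sqr_ge0.
rewrite -[ltRHS]invf_div expRN ltf_pV2 ?posrE ?expR_gt0//; last first.
  by rewrite divr_gt0// mulr_gt0.
apply: lt_le_trans (expR_ge1Dx _).
have rE : 4 * r / c <= 12 * S / c.
  by rewrite ler_pM2r ?invr_gt0// /r; lra.
have rr : r ^+ 2 = S ^+ 2 * q ^+ 2 + 4 * (S * q) + 4 by rewrite /r; ring.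
have eL : 10 * S + 24 / c * S < eps * (2 * L).
  by rewrite -S2 -mulrDl expr2 mulrA ltr_pM2r.
have E' : E = eps * L - m - 2 * (S * q) - 2.
  by rewrite /E rr q2 S2; lra.
by rewrite E'; lra.
Qed.

(** For [t > s >= 0], [gauss_tail_decay] gives [t^2 - s^2 <= 4], and
    [(t - s)^2 <= t^2 - s^2]. *)
Lemma gauss_quantile_shift s t : 0 <= s -> 0 < gauss_tail s ->
  expR (- 2) * gauss_tail s <= gauss_tail t -> t <= s + 2.
Proof.
move=> s0 Qs0 Qst; have [ts|st] := leP t s; first by lra.
have := gauss_tail_decay (ltW st).
move=> /(le_trans Qst); rewrite ler_pM2r// ler_expR => st2.
by rewrite leNgt; apply/negP => ?; nra.
Qed.

End quantiles.

(** * The sequences lambda_n and tlambda_n *)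

Section lambda.
Context {R : realType}.

(** Since [lambda_n = lambda L e^(- alpha L)], a quarter of the exponent is
    kept as the bound and the other three quarters absorb [L] and the constant
    [K = 1 + 2 sqrt (2 / lambda)], which bounds [tlambda_n / lambda_n]. *)
Lemma lambda_bounds (lambda alpha : R) n :
  let L : R := ln n%:R in
  0 < lambda < 1 -> 0 < alpha < 1 ->
  12 <= alpha * L ->
  32 * (1 + 2 * Num.sqrt (2 / lambda)) <= 9 * alpha ^+ 2 * L ->
  [/\ 0 < lambda_n lambda alpha n,
      lambda_n lambda alpha n <= tlambda_n lambda alpha n,
      tlambda_n lambda alpha n <= expR (- (alpha * L / 4)) &
      expR (- (alpha * L / 4)) <= 4^-1].
Proof.
move=> L /andP[l0 l1] /andP[a0 a1] h12 hK.
have L0 : 0 < L by rewrite -(pmulr_rgt0 _ a0); lra.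
have n1 : 1 < n%:R :> R.
  by rewrite ltNge; apply/negP => /(@ln_le0 R); rewrite -/L leNgt L0.
have n0 : 0 < n%:R :> R by lra.
have e4 : expR (- (alpha * L / 4)) <= 4^-1.
  rewrite expRN lef_pV2 ?posrE ?expR_gt0//.
  by apply: le_trans (expR_ge1Dx _); lra.
set K := 1 + 2 * Num.sqrt (2 / lambda) in hK.
have K1 : 1 <= K by rewrite lerDl mulr_ge0// sqrtr_ge0.
have lamE : lambda_n lambda alpha n = lambda * L * expR (- (alpha * L)).
  by rewrite /lambda_n /powR gt_eqF// expRN.
have lam0 : 0 < lambda_n lambda alpha n by rewrite lamE !mulr_gt0 ?expR_gt0.
have Klam : K * lambda_n lambda alpha n <= expR (- (alpha * L / 4)).
  rewrite lamE.
  have -> : - (alpha * L) = 3 * alpha * L / 4 * -1 - alpha * L / 4 by lra.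
  rewrite expRD mulrN1 !mulrA ler_piMl ?expR_ge0// expRN.
  rewrite ler_pdivrMr ?expR_gt0// mul1r.
  have x0 : 0 <= 3 * alpha * L / 4 by nra.
  apply: le_trans (expR_ge1Dxn 1 x0).
  have -> : 2`!%:R = 2 :> R by [].
  have KL : K * lambda * L <= K * L by rewrite ler_pM2r// ler_piMr//; lra.
  apply: (le_trans KL).
  have : K * L <= 9 * alpha ^+ 2 * L / 32 * L by rewrite ler_pM2r//; lra.
  by lra.
have lam1 : lambda_n lambda alpha n <= 4^-1.
  by apply: le_trans e4; apply: le_trans Klam; rewrite ler_peMl// ltW.
have pn : 1 <= n%:R `^ ((1 - alpha) / 2) :> R.
  by rewrite -[leLHS](powRr0 n%:R) ler_powR; lra.
have frac : 0 <= (1 - lambda_n lambda alpha n) / n%:R `^ ((1 - alpha) / 2) <= 1.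
  apply/andP; split; first by rewrite divr_ge0//; lra.
  by rewrite ler_pdivrMr; lra.
have s0 : 0 <= 2 * Num.sqrt (2 / lambda) by rewrite mulr_ge0// sqrtr_ge0.
case/andP: frac => f0 f1.
split => //.
- by rewrite /tlambda_n ler_peMr ?(ltW lam0)// lerDl mulr_ge0.
- apply: le_trans Klam; rewrite /tlambda_n mulrC ler_pM2r// /K lerD2l.
  by rewrite ler_piMr.
Qed.

End lambda.

(** * Spacings at a fixed large index *)

Section spacings.
Context {R : realType}.
Variables (delta eps lambda alpha : R).
Hypothesis eps01 : 0 < eps < 1.
Hypotheses (lambda01 : 0 < lambda < 1) (alpha01 : 0 < alpha < 1).
Implicit Types (n j k : nat).

Let L n : R := ln n%:R.
Let eta : R := eps / 3.
(* The upper quartile: any level in ]0, gauss_tail 0[ = ]0, 1/2[ would give a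
   fixed positive point with a known tail. *)
Let c : R := gauss_tail_inv 4^-1.

Let c_tail : gauss_tail c = 4^-1.
Proof. by apply: gauss_tail_invP; rewrite invr_gt0 invf_lt1//; lra. Qed.

Let c_gt0 : 0 < c.
Proof.
by apply: gauss_tail_lt; rewrite c_tail gauss_tail0 ltf_pV2 ?posrE//; lra.
Qed.

Let eta_gt0 : 0 < eta.
Proof. by case/andP: eps01 => e0 _; rewrite /eta; lra. Qed.

Let eta_lt : eta < 3^-1.
Proof. by case/andP: eps01 => _ e1; rewrite /eta; lra. Qed.

(** The finitely many thresholds that [n] has to pass, collected so that the
    remaining arguments take place at a fixed [n]. *)
Record sufficiently_large n k : Prop := SufficientlyLarge {
  ln_ge1 : 1 <= L n;
  alpha_ln : 12 <= alpha * L n;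
  alpha2_ln : 32 * (1 + 2 * Num.sqrt (2 / lambda)) <= 9 * alpha ^+ 2 * L n;
  lambda_ln : 1 <= lambda * L n;
  eta_sqrt_ln : 1 + c^-1 <= eta * Num.sqrt (2 * L n) / 2;
  eps_sqrt_ln : 10 + 24 / c < eps * Num.sqrt (2 * L n);
  eta_lnln : 2 <= eta * ln (L n);
  delta_lnln : (1 + delta) * ln (L n) <= expR (eta * ln (L n));
  ln_le_k : L n <= k%:R;
  lnk_le : ln (k%:R : R) <= (1 - alpha) * L n
}.

(** The argument is [(ln n)^eta / n], written as an exponential. The power
    [(ln n)^eta] is large enough for the minimum to be below [- min_level]
    except with probability [exp (- (ln n)^eta)], and small enough to be
    negligible with respect to any [j >= k >= ln n]. *)
Definition min_level n : R := gauss_tail_inv (expR (eta * ln (L n) - L n)).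

(** The factor [e^2] beats the [e^j] in ['C(n, j) <= (n e / j)^j] with room for
    a geometric series in [j]. *)
Definition stat_level n j : R := gauss_tail_inv (j%:R / (n%:R * expR 2)).

Lemma near_ln (M : R) : \forall n \near \oo, M <= L n.
Proof.
near=> n; rewrite -[M]expRK ler_ln ?posrE ?expR_gt0//.
  near: n; exact: nbhs_infty_ger.
rewrite ltr0n; near: n; exact: nbhs_infty_gt.
Unshelve. all: by end_near. Qed.

Lemma near_lnln (M : R) : \forall n \near \oo, M <= ln (L n).
Proof.
near=> n; have ML : expR M <= L n by near: n; exact: near_ln.
by rewrite -[M]expRK ler_ln ?posrE ?expR_gt0// (lt_le_trans (expR_gt0 M)).
Unshelve. all: by end_near. Qed.

Lemma near_sqrt_ln (M : R) : \forall n \near \oo, M <= Num.sqrt (2 * L n).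
Proof.
near=> n; have ML : M ^+ 2 <= L n by near: n; exact: near_ln.
have := sqr_ge0 M; move=> M2; apply: ler_of_sqr; first exact: sqrtr_ge0.
by rewrite sqr_sqrtr; lra.
Unshelve. all: by end_near. Qed.

(** The growth of [k] enters through [k >= ln n], which makes [ln k] dominate
    [eta * ln (ln n)], and through [k <= n^(1 - alpha)], which puts the
    indices of (b) in the range that the event controls. *)
Lemma near_sufficiently_large (k : nat -> nat) :
  ((k n)%:R / L n @[n --> \oo] --> +oo) ->
  (ln ((k n)%:R : R) / L n @[n --> \oo] --> (0 : R)) ->
  \forall n \near \oo, sufficiently_large n (k n).
Proof.
move=> kL lnkL.
case/andP: alpha01 => a0 a1; case/andP: lambda01 => l0 l1.
case/andP: eps01 => e0 e1.
near=> n.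
have L1 : 1 <= L n by near: n; exact: near_ln.
have L0 : 0 < L n by lra.
split => //.
- rewrite -ler_pdivrMl// mulrC; near: n; exact: near_ln.
- have b0 : 0 < 9 * alpha ^+ 2 by rewrite mulr_gt0// exprn_gt0.
  rewrite -ler_pdivrMl// mulrC; near: n; exact: near_ln.
- rewrite -ler_pdivrMl// mulrC; near: n; exact: near_ln.
- have S_ge : (1 + c^-1) / (eta / 2) <= Num.sqrt (2 * L n).
    by near: n; exact: near_sqrt_ln.
  rewrite ler_pdivrMr ?divr_gt0// in S_ge; lra.
- rewrite -ltr_pdivrMl// mulrC.
  apply: (@lt_le_trans _ _ ((10 + 24 / c) / eps + 1)); first by rewrite ltrDl.
  near: n; exact: near_sqrt_ln.
- rewrite -ler_pdivrMl// mulrC; near: n; exact: near_lnln.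
- have y0 : 0 <= ln (L n) by near: n; exact: near_lnln.
  have y1 : 2 * (1 + delta) / eta ^+ 2 <= ln (L n) by near: n; exact: near_lnln.
  have x0 : 0 <= eta * ln (L n) by rewrite mulr_ge0// ltW.
  have := expR_ge1Dxn 1 x0; have -> : 2`!%:R = 2 :> R by [].
  rewrite ler_pdivrMr ?exprn_gt0// in y1.
  by have := ler_wpM2r y0 y1; lra.
- have : 1 <= (k n)%:R / L n by near: n; move/cvgryPge : kL; apply.
  by rewrite ler_pdivlMr// mul1r.
- rewrite -ler_pdivrMr//; near: n; apply: (cvgr_le _ lnkL).
  by rewrite subr_gt0.
Unshelve. all: by end_near. Qed.

Section large_index.
Variables (n k : nat).
Hypothesis nk : sufficiently_large n k.

Let L_gt0 : 0 < L n. Proof. by have := ln_ge1 nk; lra. Qed.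

Let n_gt1 : 1 < n%:R :> R.
Proof. by rewrite ltNge; apply/negP => /(@ln_le0 R); rewrite leNgt L_gt0. Qed.

Let n_gt0 : 0 < n%:R :> R. Proof. by have := n_gt1; lra. Qed.

Let nE : n%:R = expR (L n). Proof. by rewrite lnK. Qed.

Let k_gt0 : 0 < k%:R :> R. Proof. exact: lt_le_trans L_gt0 (ln_le_k nk). Qed.

Lemma min_levelE : gauss_tail (min_level n) = expR (eta * ln (L n) - L n).
Proof.
apply: gauss_tail_invP; rewrite expR_gt0 expR_lt1 subr_lt0/=.
apply: le_lt_trans (ln_sublinear L_gt0).
rewrite ler_piMl//; last by have := eta_lt; lra.
by rewrite ln_ge0// (ln_ge1 nk).
Qed.

Lemma stat_levelE j : (0 < j <= n)%N ->
  gauss_tail (stat_level n j) = j%:R / (n%:R * expR 2).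
Proof.
move=> /andP[j0 jn]; apply: gauss_tail_invP.
have e2 : 1 < expR 2 :> R by rewrite expR_gt1.
rewrite divr_gt0 ?ltr0n// ?mulr_gt0 ?expR_gt0//=.
rewrite ltr_pdivrMr ?mulr_gt0 ?expR_gt0// mul1r.
have : j%:R <= n%:R :> R by rewrite ler_nat.
by move=> jn'; have := n_gt0; nra.
Qed.

Context d (T : measurableType d) (P : probability T R).
Variable X : 'I_n -> {RV P >-> R}.
Hypothesis iidX : iid_standard_gaussian X.

Let Omega := good_event X (min_level n) (stat_level n) k.

Lemma prob_Omega :
  (P Omega >= (1 - 4 * (1 / L n `^ (1 + delta)
     + expR (- (k%:R / 16)) / (1 - expR (- (1 / 16)))))%:E)%E.
Proof.
apply: le_trans (prob_good_event iidX _ _ _); rewrite lee_fin lerB//.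
have A : expR (- (n%:R * gauss_tail (min_level n))) <= 1 / L n `^ (1 + delta).
  rewrite min_levelE nE -expRD addrC subrK div1r /powR gt_eqF// -expRN ler_expR.
  by rewrite lerN2 (delta_lnln nk).
have B : \sum_(k <= j < n.+1) 'C(n, j)%:R * gauss_tail (stat_level n j) ^+ j <=
    expR (- (k%:R / 16)) / (1 - expR (- (1 / 16))).
  rewrite div1r; apply: le_trans (@sum_expR_tail R 16^-1 k n.+1 _) => //.
  rewrite big_nat [leRHS]big_nat; apply: ler_sum => j /andP[kj jn].
  have j0 : (0 < j)%N by apply: leq_trans kj; rewrite -(ltr0n R).
  rewrite stat_levelE ?j0//; apply: le_trans (bin_expR_le _ _) _.
    by rewrite -(ltr0n R).
  by rewrite ler_expR lerN2; have := ler0n R j; lra.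
have A0 : 0 <= 1 / L n `^ (1 + delta) by rewrite div1r invr_ge0 powR_ge0.
have B0 : 0 <= expR (- (k%:R / 16)) / (1 - expR (- (1 / 16))) :> R.
  by rewrite divr_ge0 ?expR_ge0// subr_ge0 expR_le1; lra.
by lra.
Qed.

(** Part (a). The factor [e^2] in one level and the power [(ln n)^eta] in the
    other cost [2 + eta * ln (ln n)] in the logarithm of the ratio of tails,
    which is at most [2 * eta * ln j] because [j >= ln n] and
    [2 <= eta * ln (ln n)]. *)
Lemma spacing_intermediate w : Omega w -> forall j,
  (k <= j)%N -> j%:R <= n%:R * tlambda_n lambda alpha n ->
  2 * L n * (1 - Num.sqrt (1 - ln j%:R / L n)) * (1 - eps) <=
  Num.sqrt (2 * L n) *
    (order_stat (fun i => X i w) j - order_stat (fun i => X i w) 1).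
Proof.
move=> Ow j kj jtl.
have [lam0 lamt tle e4] :=
  @lambda_bounds R _ _ _ lambda01 alpha01 (alpha_ln nk) (alpha2_ln nk).
have jn4 : j%:R <= n%:R * 4^-1 :> R.
  by apply: (le_trans jtl); rewrite ler_pM2l// (le_trans tle).
have j0 : (0 < j)%N by apply: leq_trans kj; rewrite -(ltr0n R).
have j0' : 0 < j%:R :> R by rewrite ltr0n.
have jn : (j <= n)%N by rewrite -(ler_nat R); have := n_gt0; lra.
have Xmin := good_event_min Ow.
have Xj := good_event_ge Ow j0; rewrite kj jn in Xj.
have jE : j%:R = expR (ln j%:R) :> R by rewrite lnK.
have Q2 : gauss_tail (stat_level n j) = expR (ln j%:R - 2 - L n).
  rewrite stat_levelE ?j0// !expRB -jE -nE.
  by field; rewrite !gt_eqF// expR_gt0.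
have lnLj : ln (L n) <= ln j%:R.
  rewrite ler_ln ?posrE// (le_trans (ln_le_k nk))//.
  by rewrite ler_nat.
have hml : 2 + eta * ln (L n) <= 2 * eta * ln j%:R.
  have := eta_lnln nk; have := ler_wpM2l (ltW eta_gt0) lnLj; lra.
have m0 : 0 <= eta * ln (L n) by have := eta_lnln nk; lra.
have lj0 : 0 < ln j%:R :> R.
  by rewrite -(pmulr_rgt0 _ eta_gt0); lra.
have t21 : stat_level n j <= min_level n.
  apply/ltW/gauss_tail_lt; rewrite Q2 min_levelE ltr_expR.
  have : eta * ln j%:R <= 3^-1 * ln j%:R.
    by rewrite ler_pM2r// ltW.
  lra.
have ct2 : c <= stat_level n j.
  apply/ltW/gauss_tail_lt; rewrite c_tail stat_levelE ?j0//.
  rewrite ltr_pdivrMr ?mulr_gt0 ?expR_gt0//.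
  have e2 : 1 < expR 2 :> R by rewrite expR_gt1.
  apply: (le_lt_trans jn4); rewrite mulrCA ltr_pM2l//.
  by rewrite ltr_pMr// invr_gt0.
have := @gauss_quantile_gap R c eta (L n) (ln j%:R) (eta * ln (L n)) _ _ eta_gt0
  c_gt0 m0 _ hml (eta_sqrt_ln nk) _ min_levelE Q2.
rewrite lj0 ct2 t21 ler_ln ?posrE// ler_nat jn => /(_ isT isT).
have -> : 3 * eta = eps by rewrite /eta; field.
move=> /le_trans; apply; rewrite ler_wpM2l ?sqrtr_ge0//.
by have := Xj isT; lra.
Qed.

(** Part (b): here [k <= n lambda_n <= j], hence the event controls the [j]-th
    value, and [Q(t2) = j / (n e^2) >= lambda_n / e^2] puts [t2] within 2 of
    [G(lambda_n)]. *)
Lemma spacing_large w : Omega w -> forall j,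
  n%:R * tlambda_n lambda alpha n <= j%:R -> (j <= n)%N ->
  2 * L n * Num.sqrt (1 - eps)
    - gauss_tail_inv (lambda_n lambda alpha n) * Num.sqrt (2 * L n) <
  Num.sqrt (2 * L n) *
    (order_stat (fun i => X i w) j - order_stat (fun i => X i w) 1).
Proof.
move=> Ow j tlj jn.
have [lam0 lamt tle e4] :=
  @lambda_bounds R _ _ _ lambda01 alpha01 (alpha_ln nk) (alpha2_ln nk).
set lam := lambda_n lambda alpha n in lam0 lamt *.
have lamj : n%:R * lam <= j%:R by apply: le_trans tlj; rewrite ler_pM2l.
have kj : (k <= j)%N.
  (* k <= n^(1 - alpha) <= n lambda_n *)
  rewrite -(ler_nat R); apply: le_trans lamj.
  have kE : k%:R = expR (ln k%:R) :> R by rewrite lnK.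
  rewrite kE /lam /lambda_n /powR gt_eqF// -/(L n).
  have -> : n%:R * (lambda * L n / expR (alpha * L n)) =
      expR ((1 - alpha) * L n) * (lambda * L n).
    rewrite mulrBl mul1r expRB -nE; field.
    by rewrite gt_eqF// expR_gt0.
  apply: le_trans (_ : _ <= expR ((1 - alpha) * L n)) _.
    by rewrite ler_expR (lnk_le nk).
  by rewrite ler_peMr ?expR_ge0// (lambda_ln nk).
have j0 : (0 < j)%N by apply: leq_trans kj; rewrite -(ltr0n R).
have Xmin := good_event_min Ow.
have Xj := good_event_ge Ow j0; rewrite kj jn in Xj.
have lam4 : lam <= 4^-1 by lra.
have Qlam : gauss_tail (gauss_tail_inv lam) = lam.
  by apply: gauss_tail_invP; rewrite lam0/=; lra.
have s0 : 0 <= gauss_tail_inv lam.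
  by apply/ltW/gauss_tail_lt; rewrite Qlam gauss_tail0; lra.
have t2s : stat_level n j <= gauss_tail_inv lam + 2.
  apply: gauss_quantile_shift; rewrite ?Qlam// stat_levelE ?j0//.
  rewrite invfM [leRHS]mulrA expRN [leLHS]mulrC ler_pM2r ?invr_gt0 ?expR_gt0//.
  by rewrite ler_pdivlMr// mulrC.
have mL : eta * ln (L n) <= ln (L n).
  rewrite ler_piMl//; last by have := eta_lt; lra.
  by rewrite ln_ge0// (ln_ge1 nk).
have := gauss_quantile_lower eps01 c_gt0 c_tail (ln_ge1 nk) mL (eps_sqrt_ln nk)
  min_levelE.
set S := Num.sqrt (2 * L n); set q := Num.sqrt (1 - eps).
have S2 : 2 * L n = S * S by rewrite -expr2 sqr_sqrtr// mulr_ge0// ltW.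
have S0 : 0 < S by rewrite sqrtr_gt0 mulr_gt0.
move=> t1S; rewrite S2.
have -> : S * S * q - gauss_tail_inv lam * S = S * (S * q - gauss_tail_inv lam).
  ring.
rewrite ltr_pM2l//.
by have := Xj isT; lra.
Qed.

End large_index.
End spacings.

(** * Asymptotic statement *)

Theorem proposition2p2 (R : realType) (d : measure_display)
  (T : measurableType d) (P : probability T R)
  (X : forall n : nat, 'I_n -> {RV P >-> R})
  (iidX : forall n : nat, iid_standard_gaussian (X n))
  (delta eps lambda alpha : R)
  (delta_gt0 : 0 < delta) (eps01 : 0 < eps < 1)
  (lambda01 : 0 < lambda < 1) (alpha01 : 0 < alpha < 1)
  (k : nat -> nat) (k_gt0 : forall n : nat, (0 < k n)%N)
  (k_oo : ((k n)%:R : R) @[n --> \oo] --> +oo)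
  (k_ln_oo : (k n)%:R / ln (n%:R : R) @[n --> \oo] --> +oo)
  (lnk_ln_0 : ln ((k n)%:R : R) / ln (n%:R : R) @[n --> \oo] --> (0 : R)) :
  let XX (n j : nat) (w : T) : R := order_stat (fun i : 'I_n => X n i w) j in
  let L (n : nat) : R := ln n%:R in
  exists (n0 : nat) (Omega : nat -> set T),
    (forall n : nat, (n0 <= n)%N ->
      [/\ measurable (Omega n),
          (P (Omega n) >=
             (1 - 4 * (1 / L n `^ (1 + delta)
                       + expR (- ((k n)%:R / 16)) / (1 - expR (- (1 / 16)))))%:E)%E,
          (forall w : T, Omega n w -> forall j : nat,
             (k n <= j)%N -> j%:R <= n%:R * tlambda_n lambda alpha n ->
             Num.sqrt (2 * L n) * (XX n j w - XX n 1%N w) >=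
             2 * L n * (1 - Num.sqrt (1 - ln j%:R / L n)) * (1 - eps))
        & (forall w : T, Omega n w -> forall j : nat,
             n%:R * tlambda_n lambda alpha n <= j%:R -> (j <= n)%N ->
             Num.sqrt (2 * L n) * (XX n j w - XX n 1%N w) >
             2 * L n * Num.sqrt (1 - eps)
             - gauss_tail_inv (lambda_n lambda alpha n) * Num.sqrt (2 * L n))]) /\
    (forall j : nat -> nat,
       (forall n : nat, (0 < n)%N -> (0 < j n <= n)%N) ->
       ln ((j n)%:R : R) / L n @[n --> \oo] --> (1 : R) ->
       \forall n \near \oo, forall w : T, Omega n w ->
         Num.sqrt (2 * L n) * (XX n (j n) w - XX n 1%N w) >
         2 * L n * Num.sqrt (1 - eps)
         - gauss_tail_inv (lambda_n lambda alpha n) * Num.sqrt (2 * L n)).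
Proof.
move=> XX L.
have large :=
  near_sufficiently_large delta eps01 lambda01 alpha01 k_ln_oo lnk_ln_0.
have [n0 _ n0P] := large.
exists n0, (fun n => good_event (X n) (min_level eps n) (stat_level n) (k n)).
split=> [n /n0P nk|j jn lnj].
  split.
  - exact: measurable_good_event.
  - exact: prob_Omega nk _ _ _ _ (iidX n).
  - exact: spacing_intermediate nk _ _ _ _.
  - exact: spacing_large nk _ _ _ _.
case/andP: (alpha01) => a0 a1.
near=> n => w Ow.
have nk : sufficiently_large delta eps lambda alpha n (k n) by near: n.
have L1 : 1 <= L n := ln_ge1 nk.
have n_gt0 : (0 < n)%N by near: n; exact: nbhs_infty_gt.
have /andP[j0 jle] := jn n n_gt0.
apply: (spacing_large eps01 lambda01 alpha01 nk Ow) => //.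
have [_ _ tle _] :=
  @lambda_bounds R _ _ _ lambda01 alpha01 (alpha_ln nk) (alpha2_ln nk).
(* j exceeds n^(1 - alpha/4) >= n tlambda_n eventually, so part (b) applies *)
have : 1 - alpha / 4 <= ln (j n)%:R / L n.
  by near: n; apply: (cvgr_ge _ lnj); lra.
rewrite ler_pdivlMr; last by lra.
move=> lj; have nE : n%:R = expR (L n) by rewrite lnK// posrE ltr0n.
rewrite -[leRHS]lnK ?posrE ?ltr0n//.
apply: le_trans (_ : _ <= n%:R * expR (- (alpha * L n / 4))) _.
  by rewrite ler_pM2l// ltr0n.
by rewrite nE -expRD ler_expR; lra.
Unshelve. all: by end_near. Qed.
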